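(* For all integers $m\geq n\geq 3$, $$R(P_3,nK_2,mK_2)=2m+n-1.$$
   Context: All graphs are finite, simple and undirected. $P_3$ denotes the path on three vertices, $K_N$ is the complete graph on $N$ vertices, and $kK_2$ denotes the graph consisting of $k$ pairwise disjoint edges (a matching of size $k$ on $2k$ vertices). For graphs $G_1,\dots,G_t$, the multicolor Ramsey number $R(G_1,\dots,G_t)$ is the smallest positive integer $N$ such that whenever the edges of $K_N$ are partitioned into $t$ disjoint color classes (possibly empty) giving $t$ graphs $H_1,\dots,H_t$, at least one $H_i$ has a (not necessarily induced) subgraph isomorphic to $G_i$. *)

(* Defs.v *)
From mathcomp Require Import all_boot.

Set Implicit Arguments.
Unset Strict Implicit.
Unset Printing Implicit Defensive.

Record graph_on (V : finType) := GraphOn {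
  adj :> rel V;
  adj_sym : symmetric adj;
  adj_irr : irreflexive adj
}.

Record graph := Graph {
  vertex : finType;
  graph_struct :> graph_on vertex
}.

Lemma complete_sym N : symmetric (fun x y : 'I_N => x != y).
Proof. by move=> x y; rewrite eq_sym. Qed.

Lemma complete_irr N : irreflexive (fun x y : 'I_N => x != y).
Proof. by move=> x; rewrite eqxx. Qed.

Definition complete_graph (N : nat) : graph_on 'I_N :=
  GraphOn (@complete_sym N) (@complete_irr N).

Definition path_adj k : rel 'I_k := fun x y => (x.+1 == y) || (y.+1 == x).

Lemma path_sym k : symmetric (@path_adj k).
Proof. by move=> x y; rewrite /path_adj orbC. Qed.

Lemma path_irr k : irreflexive (@path_adj k).
Proof. by move=> x; rewrite /path_adj orbb gtn_eqF. Qed.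

Definition path_graph (k : nat) : graph :=
  Graph (GraphOn (@path_sym k) (@path_irr k)).

(* k K_2: the i-th edge joins (i, false) and (i, true). *)
Definition matching_adj k : rel ('I_k * bool) :=
  fun x y => (x.1 == y.1) && (x.2 != y.2).

Lemma matching_sym k : symmetric (@matching_adj k).
Proof.
by move=> x y; rewrite /matching_adj (eq_sym x.1) (eq_sym x.2).
Qed.

Lemma matching_irr k : irreflexive (@matching_adj k).
Proof. by move=> x; rewrite /matching_adj !eqxx. Qed.

Definition matching_graph (k : nat) : graph :=
  Graph (GraphOn (@matching_sym k) (@matching_irr k)).

Definition has_subgraph (V W : finType) (H : graph_on W) (G : graph_on V) :
    Prop :=
  exists f : V -> W, injective f /\ forall x y, G x y -> H (f x) (f y).

(* Each H i is irreflexive, hence automatically a subgraph of K_N. *)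
Definition edge_partition (N t : nat) (H : 'I_t -> graph_on 'I_N) : Prop :=
  forall x y, complete_graph N x y -> exists! i, H i x y.

(* The default of nth is never used, since i < size G. *)
Definition arrows (N : nat) (G : seq graph) : Prop :=
  forall H : 'I_(size G) -> graph_on 'I_N, edge_partition H ->
    exists i, has_subgraph (H i) (nth (path_graph 0) G i).

(* R(G_1, ..., G_t) = N, as a relation: the minimum over an undecided
   predicate is not a computable function of G. *)
Definition is_ramsey_number (G : seq graph) (N : nat) : Prop :=
  [/\ 0 < N, arrows N G & forall M, 0 < M -> arrows M G -> N <= M].

(* Main.v *)
Require Import Defs.
From mathcomp Require Import all_boot.
From mathcomp Require Import zify.

Set Implicit Arguments.
Unset Strict Implicit.
Unset Printing Implicit Defensive.

(** The lower bound is witnessed by a colouring of a complete graph on at most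
    2m + n - 2 vertices that leaves the first class empty: the second class
    consists of the edges meeting a fixed set of n - 1 vertices, so its
    matchings have fewer than n edges, and the third class lives on at most
    2m - 1 vertices.

    For the upper bound, a first class without P_3 is a matching, so that the
    other two classes, blue and red, together miss at most one edge at each
    vertex; such a union is called nearly complete below. A blue matching with
    n edges or a red one with m edges is found, for all m >= n >= 2, by
    induction, removing two or three vertices at a time.

    Diagonal case m = n ([diagonal_matchable]). If only one colour occurs, a
    greedy choice gives the matching ([nearly_complete_matchable]). Otherwise
    some vertex v has a red neighbour x and a blue neighbour y
    ([bichromatic_vertex]). Removing v, x and y takes 3 = 3n - 1 - (3(n-1) - 1)
    vertices, and whichever colour the induction hypothesis supplies, one of the
    edges vx and vy completes the matching. This descends to n = 2, where at
    least five vertices are left and a short argument applies ([five_vertices]).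

    General case ([unbalanced_matchable]): a red edge can be removed with its
    two ends, which lowers m by one, until m = n; if there is no red edge, then
    everything is blue and the greedy choice applies again. *)

(* The distinctness of a list of vertices is used up to order and symmetry;
   this reads it off pair by pair from the hypothesis U. *)
Ltac distinct U :=
  move: U; rewrite /= !inE !negb_or;
  repeat match goal with
  | |- is_true (_ && _) -> _ => case/andP
  | |- is_true _ -> _ => intro
  end;
  repeat (apply/andP; split); first [done | rewrite eq_sym; done].

(** * Matchings inside a vertex set *)

Section Matchings.

Variable T : finType.
Implicit Types (A B : {set T}) (e b r : rel T).

(** The recursive form lets a matching grow by one edge in a single step; the
    link with embeddings of k K_2 is [matchable_subgraph]. *)
Fixpoint matchable e k A : Prop :=
  if k is k'.+1 then
    exists x y, [/\ x \in A, y \in A, e x y & matchable e k' (A :\: [set x; y])]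
  else True.

Lemma leq_card_setD A B : #|A| <= #|B| + #|A :\: B|.
Proof. by rewrite -(cardsID B A) leq_add2r subset_leq_card ?subsetIr. Qed.

Lemma cards2_leq (x y : T) : #|[set x; y]| <= 2.
Proof. by rewrite cards2; case: eqP. Qed.

Lemma matchableS e k A B : A \subset B -> matchable e k A -> matchable e k B.
Proof.
elim: k A B => // k IHk A B sAB [x [y [xA yA exy mA]]].
exists x, y; split=> //; try exact: (subsetP sAB).
exact: IHk (setSD _ sAB) mA.
Qed.

Lemma matchable_cons e k A B x y :
    x \in A -> y \in A -> e x y ->
    B \subset A -> x \notin B -> y \notin B -> matchable e k B ->
  matchable e k.+1 A.
Proof.
move=> xA yA exy sBA xB yB mB; exists x, y; split=> //.
by apply: matchableS mB; rewrite -setDDl !subsetD1 sBA xB yB.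
Qed.

Lemma matchable_embedding e k A :
    irreflexive e -> matchable e k A ->
  exists f : 'I_k * bool -> T,
    [/\ injective f, forall p, f p \in A
      & forall i, e (f (i, false)) (f (i, true))].
Proof.
move=> eI; elim: k A => [|k IHk] A /=.
  move=> _; exists (fun p : 'I_0 * bool => False_rect T (notF (ltn_ord p.1))).
  by split=> -[[]].
case=> x [y [xA yA exy /IHk [f [fI fA fe]]]].
have xy : x != y by apply: contraTneq exy => ->; rewrite eI.
pose g p := if unlift ord0 p.1 is Some j then f (j, p.2)
            else if p.2 then y else x.
have fD p : [/\ f p != x, f p != y & f p \in A].
  by move: (fA p); rewrite !inE negb_or -andbA => /and3P[].
exists g; split.
- move=> [i c] [j d]; rewrite /g /=.
  case: (unliftP ord0 i) => [i'|] ->; case: (unliftP ord0 j) => [j'|] ->.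
  + by move/fI=> [-> ->].
  + by case: (fD (i', c)) => /eqP fx /eqP fy _; case: d.
  + by case: (fD (j', d)) => /eqP fx /eqP fy _; case: c => /esym.
  + by case: c; case: d => // /eqP; rewrite ?(negPf xy) // eq_sym (negPf xy).
- move=> [i c]; rewrite /g /=; case: unliftP => [i' _|_]; last by case: c.
  by case: (fD (i', c)).
- by move=> i; rewrite /g /=; case: unliftP.
Qed.

Lemma matchable_subgraph (H : graph_on T) k A :
  matchable H k A -> has_subgraph H (matching_graph k).
Proof.
case/(matchable_embedding (@adj_irr _ H)) => f [fI _ fe].
exists f; split=> // -[i c] [j d] /andP[/= /eqP <-].
by case: c d => -[] // _; rewrite ?fe // adj_sym fe.
Qed.

(** * Nearly complete graphs *)

(** The complement of e has no P_3 inside A. *)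
Definition nearly_complete e A :=
  {in A & &, forall x y z, uniq [:: x; y; z] -> e x y || e x z}.

Lemma nearly_completeS e A B :
  B \subset A -> nearly_complete e A -> nearly_complete e B.
Proof. by move=> /subsetP sBA ncA x y z /sBA xA /sBA yA /sBA; apply: ncA. Qed.

(** Greedy choice: any three remaining vertices span an edge, and at least three
    remain before each of the k choices. *)
Lemma nearly_complete_matchable e k A :
  nearly_complete e A -> k.*2 < #|A| -> matchable e k A.
Proof.
elim: k A => // k IHk A ncA cA.
have /card_gt2P[x [y [z [[xA yA zA] [xy yz zx]]]]] : 2 < #|A| by lia.
have extend w : w \in A -> e x w -> matchable e k.+1 A.
  move=> wA exw; exists x, w; split=> //; apply: IHk.
    by apply: nearly_completeS ncA; exact: subsetDl.
  by have := leq_card_setD A [set x; w]; have := cards2_leq x w; lia.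
have /orP[] : e x y || e x z.
- by apply: ncA => //=; rewrite !inE negb_or xy yz eq_sym zx.
- exact: extend yA.
- exact: extend zA.
Qed.

(** * Two colours *)

Lemma matchable2 e A v x p q :
    [&& v \in A, x \in A, p \in A & q \in A] -> uniq [:: v; x; p; q] ->
  e v x -> e p q -> matchable e 2 A.
Proof.
move=> /and4P[vA xA pA qA] U evx epq.
by exists v, x; split=> //; exists p, q; split=> //; rewrite !inE; distinct U.
Qed.

Section TwoColours.

Variables b r : rel T.
Hypotheses (b_sym : symmetric b) (r_sym : symmetric r).
Hypotheses (b_irr : irreflexive b) (r_irr : irreflexive r).
Hypothesis b_not_r : forall x y, b x y -> ~~ r x y.

(** Either colour of pq works: a red pq goes with vx, a blue one with vy. *)
Lemma five_vertices_edge A v x y p q :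
    [&& v \in A, x \in A, y \in A, p \in A & q \in A] ->
    uniq [:: v; x; y; p; q] ->
    r v x -> b v y -> b p q || r p q ->
  matchable b 2 A \/ matchable r 2 A.
Proof.
move=> /and5P[vA xA yA pA qA] U rvx bvy /orP[bpq|rpq].
  by left; apply: (matchable2 _ _ bvy bpq); [rewrite /= vA yA pA | distinct U].
by right; apply: (matchable2 _ _ rvx rpq); [rewrite /= vA xA pA | distinct U].
Qed.

(** By [five_vertices_edge] the pair pq may be taken uncoloured, so p and q are
    joined to v, x and y. The edge pv has a colour different from that of vx or
    from that of vy; with that edge, v again has two edges of different colours
    and the two vertices they avoid are q and one of x and y, a coloured
    pair. *)
Lemma five_vertices A v x y p q :
    nearly_complete (relU b r) A ->
    [&& v \in A, x \in A, y \in A, p \in A & q \in A] ->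
    uniq [:: v; x; y; p; q] ->
    r v x -> b v y ->
  matchable b 2 A \/ matchable r 2 A.
Proof.
move=> ncA inA U rvx bvy.
have [vA xA yA pA qA] := and5P inA.
have [bpq|npq] := boolP (b p q || r p q).
  exact: five_vertices_edge inA U rvx bvy bpq.
have joined_p : b p v || r p v.
  by have := ncA p v q pA vA qA; rewrite /= (negPf npq) orbF; apply; distinct U.
have joined_q w : w \in A -> w != p -> w != q -> b w q || r w q.
  move=> wA wp wq; have := ncA q w p qA wA pA.
  by rewrite /= !(b_sym q, r_sym q) (negPf npq) orbF; apply; distinct U.
case/orP: joined_p; rewrite (b_sym p, r_sym p) => pv.
- apply: (@five_vertices_edge A v x p y q) => //.
  + by rewrite /= vA xA pA yA qA.
  + by distinct U.
  + by apply: joined_q => //; distinct U.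
- apply: (@five_vertices_edge A v p y x q) => //.
  + by rewrite /= vA xA pA yA qA.
  + by distinct U.
  + by apply: joined_q => //; distinct U.
Qed.

(** Take a red edge xy and a blue edge zw. If they are disjoint, then one of
    the pairs yz and yw is coloured, and its two ends see both colours between
    them: either colour of that pair makes one of its ends bichromatic. *)
Lemma bichromatic_vertex A x y z w :
    nearly_complete (relU b r) A ->
    [&& x \in A, y \in A, z \in A & w \in A] -> r x y -> b z w ->
  exists v x' y', [/\ [&& v \in A, x' \in A & y' \in A], r v x' & b v y'].
Proof.
move=> ncA /and4P[xA yA zA wA]; rewrite r_sym => ryx bzw.
have bwz : b w z by rewrite b_sym.
have at_y t : t \in A -> b y t ->
    exists v x' y', [/\ [&& v \in A, x' \in A & y' \in A], r v x' & b v y'].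
  by move=> tA byt; exists y, x, t; rewrite yA xA tA.
have [yz|yz] := eqVneq y z; first by apply: (at_y w) => //; rewrite yz.
have [yw|yw] := eqVneq y w; first by apply: (at_y z) => //; rewrite yw.
have zw : z != w by apply: contraTneq bzw => ->; rewrite b_irr.
have /orP[] : relU b r y z || relU b r y w.
  by apply: ncA => //; rewrite /= !inE negb_or yz yw zw.
- case/orP=> [|ryz]; first exact: at_y.
  by exists z, y, w; rewrite zA yA wA r_sym.
- case/orP=> [|ryw]; first exact: at_y.
  by exists w, y, z; rewrite zA yA wA r_sym.
Qed.

Lemma edge_or_nearly_complete e e' A :
    nearly_complete (relU e e') A ->
  (exists x y, [/\ x \in A, y \in A & e' x y]) \/ nearly_complete e A.
Proof.
move=> ncA; case: (boolP [exists x in A, exists y in A, e' x y]).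
  by case/exists_inP=> x xA /exists_inP[y yA e'xy]; left; exists x, y.
move=> no_e'; right=> x y z xA yA zA U; have := ncA x y z xA yA zA U.
have e'F u t : u \in A -> t \in A -> e' u t = false.
  move=> uA tA; apply: contraNF no_e' => e'ut.
  by apply/exists_inP; exists u => //; apply/exists_inP; exists t.
by rewrite /= !e'F // !orbF.
Qed.

Lemma nearly_completeC e e' A :
  nearly_complete (relU e e') A -> nearly_complete (relU e' e) A.
Proof.
move=> ncA x y z xA yA zA U; have := ncA x y z xA yA zA U.
by rewrite /= ![e' _ _ || _]orbC.
Qed.

(** The induction removes the bichromatic vertex v with both its neighbours:
    edges vx' and vy' are kept in reserve until the colour of the matching on
    the remaining vertices is known. *)
Lemma diagonal_matchable n A :
    1 < n -> nearly_complete (relU b r) A -> 3 * n <= #|A|.+1 ->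
  matchable b n A \/ matchable r n A.
Proof.
elim: n A => // n IHn A n_gt0 ncA cA.
have [[x [y [xA yA rxy]]]|ncb] := edge_or_nearly_complete ncA; last first.
  by left; apply: nearly_complete_matchable => //; lia.
have [[z [w [zA wA bzw]]]|ncr] :=
  edge_or_nearly_complete (nearly_completeC ncA); last by right; apply: nearly_complete_matchable => //; lia.
have [|v [x' [y' [/and3P[vA x'A y'A] rvx bvy]]]] :=
    bichromatic_vertex ncA _ rxy bzw; first by rewrite xA yA zA wA.
pose B := A :\: [set v; x'; y'].
have sBA : B \subset A by exact: subsetDl.
have cB : #|A| <= 3 + #|B|.
  apply: leq_trans (leq_card_setD A [set v; x'; y']) _; rewrite leq_add2r.
  by rewrite setUC cardsU1; have := cards2_leq v x'; case: (_ \notin _); lia.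
case: (ltnP 1 n) => [n_gt1|n_le1].
  have [||mB|mB] := IHn B n_gt1; first exact: nearly_completeS sBA ncA.
  - by lia.
  - by left; apply: matchable_cons vA y'A bvy sBA _ _ mB;
      rewrite !inE eqxx ?orbT.
  - by right; apply: matchable_cons vA x'A rvx sBA _ _ mB;
      rewrite !inE eqxx ?orbT.
have -> : n = 1 by lia.
have /card_gt1P[p [q [pB qB pq]]] : 1 < #|B| by lia.
move: pB qB; rewrite !inE !negb_or -!andbA.
move=> /and4P[pv px py pA] /and4P[qv qx qy qA].
have vx : v != x' by apply: contraTneq rvx => <-; rewrite r_irr.
have vy : v != y' by apply: contraTneq bvy => <-; rewrite b_irr.
have xy : x' != y' by apply: contraTneq rvx => ->; exact: b_not_r.
apply: (five_vertices (p := p) (q := q) ncA _ _ rvx bvy).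
  by rewrite vA x'A y'A pA qA.
rewrite /= !inE !negb_or vx vy xy pq (eq_sym v p) pv (eq_sym v q) qv.
by rewrite (eq_sym x' p) px (eq_sym x' q) qx (eq_sym y' p) py (eq_sym y' q) qy.
Qed.

Lemma unbalanced_matchable n m A :
    1 < n -> n <= m -> nearly_complete (relU b r) A -> 2 * m + n <= #|A|.+1 ->
  matchable b n A \/ matchable r m A.
Proof.
move=> n_gt1 /subnKC <-; elim: (m - n) A => [|k IHk] A ncA cA.
  by rewrite addn0; apply: diagonal_matchable => //; lia.
have [[x [y [xA yA rxy]]]|ncb] := edge_or_nearly_complete ncA; last first.
  by left; apply: nearly_complete_matchable => //; lia.
have sBA : A :\: [set x; y] \subset A by exact: subsetDl.
have [||mB|mB] := IHk (A :\: [set x; y]); first exact: nearly_completeS sBA ncA.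
- by have := leq_card_setD A [set x; y]; have := cards2_leq x y; lia.
- by left; apply: matchableS mB.
- by right; rewrite addnS; exists x, y.
Qed.

End TwoColours.

End Matchings.

(** * The Ramsey number *)

Lemma has_path3 (T : finType) (H : graph_on T) x y z :
  y != z -> H x y -> H x z -> has_subgraph H (path_graph 3).
Proof.
move=> yz Hxy Hxz.
have U : uniq [:: y; x; z].
  rewrite /= !inE negb_or yz !andbT; apply/andP; split.
    by apply: contraTneq Hxy => ->; rewrite adj_irr.
  by apply: contraTneq Hxz => ->; rewrite adj_irr.
exists (fun i : 'I_3 => nth x [:: y; x; z] i); split.
  by move=> i j /eqP; rewrite nth_uniq // => /eqP/val_inj.
by move=> [[|[|[|i]]] ?] [[|[|[|j]]] ?]; rewrite /= // adj_sym.
Qed.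

Lemma ramsey_arrows m n :
    1 < n -> n <= m ->
  arrows (2 * m + n - 1) [:: path_graph 3; matching_graph n; matching_graph m].
Proof.
move=> n_gt1 nm H partH.
pose i0 : 'I_3 := @Ordinal 3 0 isT.
pose i1 : 'I_3 := @Ordinal 3 1 isT.
pose i2 : 'I_3 := @Ordinal 3 2 isT.
case: (boolP [exists x, exists y, exists z, [&& y != z, H i0 x y & H i0 x z]]).
  case/existsP=> x /existsP[y /existsP[z /and3P[yz Hxy Hxz]]].
  by exists i0; apply: has_path3 yz Hxy Hxz.
move=> no_path.
have nc : nearly_complete (relU (H i1) (H i2)) setT.
  move=> x y z _ _ _; rewrite /= !inE negb_or => /and3P[/andP[xy xz] yz _].
  apply: contraNT no_path; rewrite negb_or !negb_or.
  case/andP=> /andP[n1y n2y] /andP[n1z n2z].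
  apply/existsP; exists x; apply/existsP; exists y; apply/existsP; exists z.
  have in_H0 t : x != t -> ~~ H i1 x t -> ~~ H i2 x t -> H i0 x t.
    move=> xt n1 n2; have [i [Hi _]] := partH x t xt.
    case: i Hi => [[|[|[|i]]] lti] //= Hi.
    - by rewrite (_ : i0 = Ordinal lti) //; exact: val_inj.
    - by rewrite (_ : i1 = Ordinal lti) ?Hi // in n1; exact: val_inj.
    - by rewrite (_ : i2 = Ordinal lti) ?Hi // in n2; exact: val_inj.
  by rewrite yz !in_H0.
have disj x y : H i1 x y -> ~~ H i2 x y.
  move=> H1; apply/negP=> H2.
  have xy : x != y by apply: contraTneq H1 => ->; rewrite adj_irr.
  have [i [_ Ui]] := partH x y xy.
  by have := etrans (esym (Ui _ H1)) (Ui _ H2).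
have [|mb|mr] := unbalanced_matchable (@adj_sym _ (H i1)) (@adj_sym _ (H i2))
  (@adj_irr _ (H i1)) (@adj_irr _ (H i2)) disj n_gt1 nm nc.
- by rewrite cardsT card_ord; lia.
- by exists i1; apply: matchable_subgraph mb.
- by exists i2; apply: matchable_subgraph mr.
Qed.

Section ExtremalColouring.

Variables (N k : nat).

Definition cover_adj : rel 'I_N := fun x y => (x != y) && ((x < k) || (y < k)).
Definition clique_adj : rel 'I_N := fun x y => [&& x != y, k <= x & k <= y].

Lemma cover_sym : symmetric cover_adj.
Proof. by move=> x y; rewrite /cover_adj eq_sym orbC. Qed.

Lemma cover_irr : irreflexive cover_adj.
Proof. by move=> x; rewrite /cover_adj eqxx. Qed.

Lemma clique_sym : symmetric clique_adj.
Proof. by move=> x y; rewrite /clique_adj eq_sym [(k <= x) && _]andbC. Qed.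

Lemma clique_irr : irreflexive clique_adj.
Proof. by move=> x; rewrite /clique_adj eqxx. Qed.

Lemma empty_sym : symmetric (fun _ _ : 'I_N => false). Proof. by []. Qed.
Lemma empty_irr : irreflexive (fun _ _ : 'I_N => false). Proof. by []. Qed.

Definition extremal_colouring (i : 'I_3) : graph_on 'I_N :=
  match val i with
  | 0 => GraphOn empty_sym empty_irr
  | 1 => GraphOn cover_sym cover_irr
  | _ => GraphOn clique_sym clique_irr
  end.

Lemma extremal_partition : edge_partition extremal_colouring.
Proof.
move=> x y /= xy; case: (boolP ((x < k) || (y < k))) => [c|nc].
  exists (@Ordinal 3 1 isT); split; first by rewrite /= /cover_adj xy.
  move=> [[|[|[|i]]] lti] //=; first by move=> _; exact: val_inj.
  by case/and3P=> _ kx ky; move: c; rewrite !ltnNge kx ky.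
exists (@Ordinal 3 2 isT); split.
  by rewrite /= /clique_adj xy; move: nc; rewrite negb_or -!leqNgt.
move=> [[|[|[|i]]] lti] //=; last by move=> _; exact: val_inj.
by rewrite /cover_adj (negPf nc) andbF.
Qed.

(** The edges of the matching have distinct ends among the first k vertices. *)
Lemma cover_matching l :
  has_subgraph (GraphOn cover_sym cover_irr) (matching_graph l) -> l <= k.
Proof.
case=> f [fI fe].
have low i : exists c, f (i, c) < k.
  have /andP[_ /orP[]] : cover_adj (f (i, false)) (f (i, true)).
    by apply: fe; rewrite /= /matching_adj /= eqxx.
  - by exists false.
  - by exists true.
pose g i := Ordinal (xchooseP (low i)).
have gI : injective g.
  by move=> i j [] /val_inj /fI [].
by have := leq_card g gI; rewrite !card_ord.
Qed.

Lemma clique_matching l :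
    0 < l ->
    has_subgraph (GraphOn clique_sym clique_irr) (matching_graph l) ->
  k + 2 * l <= N.
Proof.
move=> l_gt0 [f [fI fe]].
have high p : k <= f p.
  case: p => i c; have /and3P[_ _] : clique_adj (f (i, ~~ c)) (f (i, c)).
    by apply: fe; rewrite /= /matching_adj /= eqxx; case: c.
  by [].
have lt p : f p - k < N - k.
  by have := ltn_ord (f p); have := high p; lia.
have gI : injective (fun p => Ordinal (lt p)).
  move=> p q [] e; apply: fI; apply: val_inj => /=.
  by have := high p; have := high q; lia.
have := leq_card _ gI; rewrite card_prod card_bool !card_ord; lia.
Qed.

End ExtremalColouring.

Lemma ramsey_lower m n N :
    0 < n -> 0 < m ->
    arrows N [:: path_graph 3; matching_graph n; matching_graph m] ->
  2 * m + n - 1 <= N.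
Proof.
move=> n_gt0 m_gt0 /(_ _ (@extremal_partition N n.-1)).
case=> -[[|[|[|i]]] lti] //=; rewrite /extremal_colouring /=.
- by case=> f [_ /(_ (@Ordinal 3 0 isT) (@Ordinal 3 1 isT) isT)].
- by move/cover_matching; lia.
- by move/(clique_matching m_gt0); lia.
Qed.

Theorem corollary3p6 (m n : nat) (hn : 3 <= n) (hmn : n <= m) :
  is_ramsey_number
    [:: path_graph 3; matching_graph n; matching_graph m]
    (2 * m + n - 1).
Proof.
split; first by lia.
- by apply: ramsey_arrows => //; lia.
- by move=> N _; apply: ramsey_lower; lia.
Qed.
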